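(* Let $X$ be a Noetherian space. Then: 1. $1 + \mathrm{sob}\, X \leq ||X|| + 1$; equivalently, when $X$ is non-empty, $1 + \mathrm{rsob}\, X \leq ||X||$; 2. $||X|| + 1 \leq \omega^{\mathrm{sob}\, X}$; 3. if $X$ is non-empty, then $||X|| \leq \omega^{\mathrm{rsob}\, X} \otimes n$, where $n$ is the number of components of $X$.
   Context: A topological space is Noetherian if every open subset is compact (every open cover has a finite subcover; no separation is required). For a well-founded poset $P$ and $x \in P$, $\mathrm{rk}_P(x) = \sup_{x' < x} (\mathrm{rk}_P(x')+1)$ and the ordinal rank of $P$ is $|P| = \sup_{x \in P} (\mathrm{rk}_P(x)+1)$, where $\sup\emptyset = 0$. $\mathcal{H}_0 X$ is the poset of all closed subsets of $X$ (including $\emptyset$), ordered by inclusion; it is well-founded when $X$ is Noetherian. The stature of a Noetherian space $X$ is $||X|| = |\mathcal{H}_0 X| - 1$, equivalently $||X|| = \mathrm{rk}_{\mathcal{H}_0 X}(X)$. A closed subset $C$ of $X$ is irreducible if it is non-empty and, whenever $C \subseteq F_1 \cup F_2$ with $F_1, F_2$ closed in $X$, we have $C \subseteq F_1$ or $C \subseteq F_2$. $\mathcal{S} X$ is the poset of irreducible closed subsets of $X$, ordered by inclusion. The sobrification rank of a Noetherian space $X$ is $\mathrm{sob}\, X = |\mathcal{S} X|$. When $X$ is non-empty, $\mathrm{sob}\, X$ is a successor ordinal and the reduced sobrification rank $\mathrm{rsob}\, X$ is $\mathrm{sob}\, X - 1$ (the ordinal whose successor is $\mathrm{sob}\, X$).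 The components of a Noetherian space $X$ are its (finitely many) maximal irreducible closed subsets with respect to inclusion. The operation $+$ is ordinary ordinal addition, $\omega^\beta$ is ordinal exponentiation, and $\otimes$ is the natural (Hessenberg) product of ordinals. *)

(* Defs.v *)
From mathcomp Require Import all_boot all_order.
From mathcomp Require Import finmap.
From mathcomp Require Import boolp classical_sets cardinality topology.

Set Implicit Arguments.
Unset Strict Implicit.
Unset Printing Implicit Defensive.

Local Open Scope classical_set_scope.

(** * Ordinals *)

(* [ssup f] stands for sup_i (f i + 1), the least ordinal strictly above every
   [f i].  Several terms may denote the same ordinal: equality of ordinals
   is [oeq], not Leibniz equality.  Index types include the carriers of all
   topological spaces, so [Ord] lives in a larger universe and cannot itself be a
   choiceType (nor can [path.sorted] be applied to lists of ordinals). *)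
Inductive Ord : Type := ssup (A : Type) (f : A -> Ord).

Declare Scope ord_scope.
Delimit Scope ord_scope with ord.
Bind Scope ord_scope with Ord.

Definition idx (a : Ord) : Type := match a with ssup A _ => A end.
Definition below (a : Ord) : idx a -> Ord :=
  match a return idx a -> Ord with ssup _ f => f end.

(* [f i < b] iff [f i] is at most some ordinal listed below [b]. *)
Fixpoint ole (a b : Ord) : Prop :=
  let: ssup A f := a in forall i : A, exists j : idx b, ole (f i) (below j).
Definition olt (a b : Ord) : Prop := exists j : idx b, ole a (below j).
Definition oeq (a b : Ord) : Prop := ole a b /\ ole b a.

(* Non-strict supremum of a family. *)
Definition osup (I : Type) (F : I -> Ord) : Ord :=
  ssup (fun p : {i : I & idx (F i)} => below (projT2 p)).

Definition ozero : Ord := ssup (fun v : void => match v with end).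
Definition osucc (a : Ord) : Ord := ssup (fun _ : unit => a).

(* The sup of all ordinals below [a]: it is b whenever a = b + 1 (and a itself
   when a is zero or a limit). *)
Definition opred (a : Ord) : Ord := let: ssup _ f := a in osup f.

Definition onat (n : nat) : Ord := iter n osucc ozero.
Definition omega : Ord := ssup onat.

(* a + b = max (a, sup_{b' < b} ((a + b') + 1)) *)
Fixpoint oadd (a b : Ord) : Ord :=
  let: ssup B g := b in
  ssup (fun z : idx a + B =>
    match z with inl i => below i | inr j => oadd a (g j) end).

(* a * b = sup_{b' < b} (a * b' + a) *)
Fixpoint omul (a b : Ord) : Ord :=
  let: ssup B g := b in osup (fun j : B => oadd (omul a (g j)) a).

(* omega ^ b = max (1, sup_{b' < b} (omega ^ b' * omega)) *)
Fixpoint oexpw (b : Ord) : Ord :=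
  let: ssup B g := b in
  osup (fun z : option B =>
    match z with None => onat 1 | Some j => omul (oexpw (g j)) omega end).

(* Natural (Hessenberg) sum: the least ordinal strictly above all hsum a' b
   (a' < a) and all hsum a b' (b' < b). *)
Fixpoint hsum (a : Ord) : Ord -> Ord :=
  let: ssup A f := a in
  fix hsum_a (b : Ord) : Ord :=
    let: ssup B g := b in
    ssup (fun z : A + B =>
      match z with inl i => hsum (f i) b | inr j => hsum_a (g j) end).

(* Cantor normal form: omega ^ a1 + ... + omega ^ ak with a1 >= ... >= ak is
   represented by the list of its exponents. *)
Definition cnf_val (s : seq Ord) : Ord :=
  foldr (fun e r => oadd (oexpw e) r) ozero s.

Definition is_cnf (a : Ord) (s : seq Ord) : Prop :=
  (forall i, (i.+1 < size s)%N -> ole (nth ozero s i.+1) (nth ozero s i)) /\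
  oeq a (cnf_val s).

(* The default [::] is never used, by the Cantor normal form theorem. *)
Definition cnf (a : Ord) : seq Ord :=
  match pselect (exists s, is_cnf a s) with
  | left h => sval (cid h)
  | right _ => [::]
  end.

(* Natural (Hessenberg) product: if a = sum_i omega ^ a_i and
   b = sum_j omega ^ b_j in Cantor normal form, the natural sum over all (i, j)
   of omega ^ (hsum a_i b_j). *)
Definition hprod (a b : Ord) : Ord :=
  foldr hsum ozero [seq oexpw (hsum x y) | x <- cnf a, y <- cnf b].

Notation "0" := ozero : ord_scope.
Notation "1" := (onat 1) : ord_scope.
Notation "a <= b" := (ole a b) : ord_scope.
Notation "a < b" := (olt a b) : ord_scope.
Notation "a + b" := (oadd a b) : ord_scope.
Notation "'ω^' b" := (oexpw b) (at level 30, b at level 9, format "'ω^' b") :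
  ord_scope.
Notation "a ⊗ b" := (hprod a b) (at level 40, left associativity) : ord_scope.

Lemma ole_refl a : (a <= a)%ord.
Proof. by elim: a => I f IH /= i; exists i. Qed.

Lemma ole_trans b a c : (a <= b)%ord -> (b <= c)%ord -> (a <= c)%ord.
Proof.
elim: a b c => I f IH [J g] [K h] /= ab bc i.
have [j ij] := ab i; have [k jk] := bc j.
by exists k; exact: IH ij jk.
Qed.

Lemma ole_sup (I : Type) (F : I -> Ord) i : (F i <= osup F)%ord.
Proof.
case E : (F i) => [J g] /= j.
have [p ->] : exists p : idx (F i), g j = below p by rewrite E; exists j.
by exists (existT _ i p); exact: ole_refl.
Qed.

Lemma osup_le (I : Type) (F : I -> Ord) c :
  (forall i, F i <= c)%ord -> (osup F <= c)%ord.
Proof. by move=> Fc [i p] /=; move: (Fc i) p; case: (F i) => J g /=; apply. Qed.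

Lemma opred_succ a : oeq (opred (osucc a)) a.
Proof.
split; first by apply: osup_le => _; exact: ole_refl.
exact: (@ole_sup _ (fun=> a) tt).
Qed.

(** * Ranks in well-founded posets *)

Section Rank.
Variables (P : Type) (lt : P -> P -> Prop).

Fixpoint rk_acc (x : P) (ax : Acc lt x) {struct ax} : Ord :=
  ssup (fun y : {x' : P | lt x' x} => rk_acc (Acc_inv ax (proj2_sig y))).

Hypothesis lt_wf : well_founded lt.

Definition rk (x : P) : Ord := rk_acc (lt_wf x).

Definition orank : Ord := ssup rk.

Lemma rk_acc_irr x (a b : Acc lt x) : (rk_acc a <= rk_acc b)%ord.
Proof.
elim/Acc_inv_dep: {x} a b => x ax IH [bx] /= y.
by exists y; exact: IH.
Qed.

Lemma rk_le x t : (forall y, lt y x -> lt y t) -> (rk x <= rk t)%ord.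
Proof.
rewrite /rk => xt; case: (lt_wf x) => ax; case: (lt_wf t) => at_ /= [y yx].
by exists (exist _ y (xt _ yx)); exact: rk_acc_irr.
Qed.

End Rank.

(** * Noetherian spaces *)

Definition noetherian (X : topologicalType) : Prop :=
  forall U : set X, open U -> cover_compact U.

Definition H0 (X : topologicalType) : Type := {C : set X | closed C}.

Definition H0_lt (X : topologicalType) (C D : H0 X) : Prop :=
  proj1_sig C `<` proj1_sig D.

Definition irreducible_closed (X : topologicalType) (C : set X) : Prop :=
  [/\ closed C, C !=set0 &
      forall F1 F2 : set X, closed F1 -> closed F2 ->
        C `<=` F1 `|` F2 -> C `<=` F1 \/ C `<=` F2].

Definition Sob (X : topologicalType) : Type :=
  {C : set X | irreducible_closed C}.

Definition Sob_lt (X : topologicalType) (C D : Sob X) : Prop :=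
  proj1_sig C `<` proj1_sig D.

Lemma H0_wf (X : topologicalType) : noetherian X -> well_founded (@H0_lt X).
Proof.
move=> nX; apply: contrapT => /existsNP[C0 nC0].
pose T := {C : H0 X | ~ Acc (@H0_lt X) C}.
have step (C : T) : {D : T | H0_lt (sval D) (sval C)}.
  apply: cid; apply: contrapT => noD; case: C noD => C nC /= noD; apply: nC.
  constructor => D DC; apply: contrapT => nD.
  by apply: noD; exists (exist _ D nD).
pose s n : T := iter n (fun C => sval (step C)) (exist _ C0 nC0).
pose F n : set X := sval (sval (s n)).
have FS n : F n.+1 `<` F n by rewrite /F /s /=; case: (step _).
have Fle m n : (m <= n)%N -> F n `<=` F m.
  elim: n => [|n IH]; first by rewrite leqn0 => /eqP ->.
  rewrite leq_eqVlt => /predU1P[-> //|/IH].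
  by apply: subset_trans; case: (FS n).
have oF n : open (~` F n) by apply: closed_openC; rewrite /F; case: (sval (s n)).
have oU : open (\bigcup_n ~` F n) by apply: bigcup_open => n _; exact: oF.
have [D _ cD] := nX _ oU nat setT (fun n => ~` F n) (fun n _ => oF n)
  (@subset_refl _ _).
pose N := \max_(i <- D) i.
case: (FS N) => _; apply => x FNx; apply: contrapT => nFx.
have [|n /= nD nFnx] := cD x; first by exists N.+1.
by apply: nFnx; apply: Fle FNx; exact: leq_bigmax_seq.
Qed.

Lemma Sob_wf (X : topologicalType) : noetherian X -> well_founded (@Sob_lt X).
Proof.
move=> nX; pose h (C : Sob X) : H0 X :=
  exist _ (sval C) (let: And3 cC _ _ := svalP C in cC).
move=> C; move: (H0_wf nX (h C)) => aC; move: {-1}(h C) (erefl (h C)) aC => c + ac.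
elim: ac C => {}c _ IH C hC; constructor => D DC.
by apply: (IH (h D)) => //; rewrite -hC.
Qed.

Section Invariants.
Variables (X : topologicalType) (nX : noetherian X).

(* |H0 X| is a successor, since H0 X has a largest element. *)
Definition stature : Ord := opred (orank (H0_wf nX)).

Definition sob : Ord := orank (Sob_wf nX).

(* For non-empty X, sob X is a successor, namely the largest rk C + 1 for C among
   the finitely many components of X. *)
Definition rsob : Ord := opred sob.

End Invariants.

Definition components (X : topologicalType) : set (set X) :=
  [set C | irreducible_closed C /\
           forall D : set X, irreducible_closed D -> C `<=` D -> D = C].

(* [components X] is finite when X is Noetherian, so this is its cardinality. *)
Definition ncomponents (X : topologicalType) : nat :=
  #|` fset_set (@components X)|.

Lemma stature_rk (X : topologicalType) (nX : noetherian X) :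
  oeq (stature nX) (rk (H0_wf nX) (exist _ [set: X] closedT)).
Proof.
split; last exact: ole_sup.
apply: osup_le => C; apply: rk_le => D [DC nCD]; split; first exact: subsetT.
by move=> TD; apply: nCD => x _; exact: TD.
Qed.

(* Main.v *)
Require Import Defs.
From mathcomp Require Import all_boot all_order.
From mathcomp Require Import finmap.
From mathcomp Require Import boolp classical_sets cardinality topology.

(** Write ||F|| for the rank of a closed set F among all closed sets and rk C for
the rank of an irreducible closed set C among the irreducible ones.

The lower bounds hold because the irreducible closed sets form a subposet of
the closed sets that omits the bottom element, the empty set: by induction,
1 + rk C <= ||C|| ([irrk_le_clrk]).

The upper bounds rest on two facts.  On the topological side, rank is
subadditive for the natural sum: if F is covered by F1 and F2, then
||F|| <= ||F1|| ⊕ ||F2|| ([clrk_cover]).  Indeed a closed set G strictly inside F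
is covered by its traces on F1 and F2, and these cannot be all of F1 and all of
F2.  On the ordinal side, powers of ω are indecomposable: the ordinals below
ω^b are closed under the natural sum ([indecomposable_oexpw]).

Together they give ||F|| < ω^b as soon as every irreducible closed subset of F
has rank < b ([clrk_lt_oexpw]), by induction on F: the empty set has rank 0; a reducible F is the union of
two smaller closed sets, whose ranks are below ω^b by induction; if F is
irreducible of rank c < b, then every G strictly inside F contains only
irreducible sets of rank < c, hence ||G|| < ω^c, so that ||F|| <= ω^c < ω^b.
Taking F = X and b = sob X yields the second claim.  For the third, X is covered
by finitely many of its components ([components_cover]), each of rank at most
ω^(rsob X), so ||X|| is bounded by a natural sum of that many copies of
ω^(rsob X); and such a sum is at most the natural product with the number of
components ([hsum_nseq_le_hprod]). *)

Set Implicit Arguments.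
Unset Strict Implicit.
Unset Printing Implicit Defensive.

Local Open Scope classical_set_scope.

(** * The order on ordinals *)

Lemma olt_below (A : Type) (f : A -> Ord) i : (f i < ssup f)%ord.
Proof. by exists i; exact: ole_refl. Qed.

Lemma ole_lt_trans b a c : (a <= b -> b < c -> a < c)%ord.
Proof. by move=> ab [i bi]; exists i; exact: ole_trans bi. Qed.

(** This characterization of [ole] by initial segments lets proofs about
operations reason about the elements of a sum instead of its index type. *)
Lemma oleP a b : (a <= b)%ord <-> forall c, (c < a -> c < b)%ord.
Proof.
case: a => A f; split=> [ab c [i ci]|ab i]; last exact: ab (olt_below f i).
exact: ole_lt_trans ci (ab i).
Qed.

Lemma olt_le_trans b a c : (a < b -> b <= c -> a < c)%ord.
Proof. by move=> ab /oleP; apply. Qed.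

Lemma oltW a b : (a < b -> a <= b)%ord.
Proof.
elim: a b => A f IH b [i]; case: b i => B g /= i fgi j.
have [k fjk] := olt_le_trans (olt_below f j) fgi.
by exists i; apply: IH; exists k.
Qed.

(** Induction on the value of an ordinal: structural induction only reaches the
terms listed in the constructor, not every smaller ordinal. *)
Lemma olt_ind (P : Ord -> Prop) :
  (forall a, (forall b, (b < a)%ord -> P b) -> P a) -> forall a, P a.
Proof.
move=> step a; apply: (step); elim: a => A f IH b [i bi].
by apply: step => c cb; apply: (IH i); exact: olt_le_trans cb bi.
Qed.

Lemma olt_irr a : ~ (a < a)%ord.
Proof. by elim/olt_ind: a => a IH lt_aa; exact: (IH a). Qed.

(** Classical: if some [f i] is not below [b], the induction hypothesis puts every
element of [b] below that [f i]. *)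
Lemma ole_total a b : (a <= b)%ord \/ (b < a)%ord.
Proof.
elim: a b => A f IH b; apply: contrapT => /not_orP[/existsNP[i nfib] nba].
apply: nba; exists i; case: b nfib => B g nfib j.
by have [fig|//] := IH i (g j); case: nfib; exists j.
Qed.

Lemma ole0 a : (0 <= a)%ord.
Proof. by case. Qed.

Lemma olt0 a : ~ (a < 0)%ord.
Proof. by case=> -[]. Qed.

Lemma olt_osucc a b : (a < osucc b)%ord <-> (a <= b)%ord.
Proof. by split=> [[]//|]; exists tt. Qed.

Lemma ole_osucc a b : (a <= b -> osucc a <= osucc b)%ord.
Proof. by move=> ab _; exists tt. Qed.

Lemma olt_osup (I : Type) (F : I -> Ord) a :
  (a < osup F)%ord <-> exists i, (a < F i)%ord.
Proof.
split=> [[[i p]] /= ap|[i]]; first by exists i, p.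
by move/olt_le_trans; apply; exact: ole_sup.
Qed.

(** * Ordinal sum and natural sum *)

Lemma olt_oadd_inv a b c :
  (c < a + b)%ord -> (c < a)%ord \/ exists2 d, (d < b)%ord & (c <= a + d)%ord.
Proof.
case: b => B g [[i|j] /= cz]; first by left; exists i.
by right; exists (g j) => //; exact: olt_below.
Qed.

Lemma oadd_le_l a b : (a <= a + b)%ord.
Proof. by case: a b => A f [B g] i; exists (inl i); exact: ole_refl. Qed.

Lemma ole_oadd a a' b b' : (a <= a' -> b <= b' -> a + b <= a' + b')%ord.
Proof.
move=> aa'; elim: b b' => B g IH [B' g'] bb' [i|j].
  have [k ik] : (below i < a')%ord.
    by apply: olt_le_trans aa'; case: (a) i => A f i; exact: olt_below.
  by exists (inl k).
by have [k jk] := bb' j; exists (inr k); exact: IH.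
Qed.

Lemma olt_oadd a b b' : (b < b' -> a + b < a + b')%ord.
Proof.
case: b' => B g [j bj]; exists (inr j).
by apply: ole_oadd => //; exact: ole_refl.
Qed.

Lemma oadd_le_r a b : (b <= a + b)%ord.
Proof. by elim: b => B g IH j; exists (inr j); exact: IH. Qed.

Lemma ole_oadd0 a : (a + 0 <= a)%ord.
Proof. by apply/oleP => c /olt_oadd_inv[//|[d /olt0]]. Qed.

Lemma ole_oadd1 a b : (a < b -> a + 1 <= b)%ord.
Proof.
move=> ab; apply/oleP => c /olt_oadd_inv[|[d /olt_osucc d0 cd]].
  by move/olt_le_trans; apply; exact: oltW.
apply: ole_lt_trans ab; apply: ole_trans cd _.
apply: ole_trans _ (@ole_oadd0 a).
by apply: ole_oadd => //; exact: ole_refl.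
Qed.

Lemma oadd1_osucc a : oeq (1 + osucc a)%ord (osucc (1 + a)%ord).
Proof.
split; last by move=> _; exists (inr tt); exact: ole_refl.
case=> [[]|[]]; exists tt; last exact: ole_refl.
exact: ole0.
Qed.

Lemma olt_hsum_inv a b c : (c < hsum a b)%ord ->
  (exists2 a', (a' < a)%ord & (c <= hsum a' b)%ord) \/
  (exists2 b', (b' < b)%ord & (c <= hsum a b')%ord).
Proof.
case: a b => A f [B g] [[i|j] /= cz].
  by left; exists (f i) => //; exact: olt_below.
by right; exists (g j) => //; exact: olt_below.
Qed.

Lemma ole_hsum a a' b b' : (a <= a' -> b <= b' -> hsum a b <= hsum a' b')%ord.
Proof.
elim: a a' b b' => A f IHa [A' f'] b b' aa'.
elim: b b' => B g IHb [B' g'] bb' [i|j].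
  by have [k ik] := aa' i; exists (inl k); exact: IHa.
by have [k jk] := bb' j; exists (inr k); exact: IHb.
Qed.

Lemma olt_hsum_l a a' b b' : (a < a' -> b <= b' -> hsum a b < hsum a' b')%ord.
Proof.
case: a' b' => A' f' [B' g'] [i ai] bb'; exists (inl i).
exact: (ole_hsum ai bb').
Qed.

Lemma olt_hsum_r a a' b b' : (a <= a' -> b < b' -> hsum a b < hsum a' b')%ord.
Proof.
case: a' b' => A' f' [B' g'] aa' [j bj]; exists (inr j).
exact: (ole_hsum aa' bj).
Qed.

Lemma hsum_ge_l a b : (a <= hsum a b)%ord.
Proof. by elim: a b => A f IH [B g] i; exists (inl i); exact: IH. Qed.

Lemma hsum_ge_r a b : (b <= hsum a b)%ord.
Proof. by case: a => A f; elim: b => B g IH j; exists (inr j); exact: IH. Qed.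

Lemma hsum0 a : (hsum a 0 <= a)%ord.
Proof. by elim: a => A f IH [i|[]]; exists i; exact: IH. Qed.

Lemma hsum0l a : (hsum 0 a <= a)%ord.
Proof. by elim: a => A f IH [[]|i]; exists i; exact: IH. Qed.

Lemma hsumC a b : (hsum a b <= hsum b a)%ord.
Proof.
elim: a b => A f IHa; elim=> B g IHb [i|j].
  by exists (inr i); exact: (IHa i (ssup g)).
by exists (inl j); exact: IHb.
Qed.

Lemma oadd_le_hsum a b : (a + b <= hsum a b)%ord.
Proof.
elim: b => B g IH; apply/oleP => c /olt_oadd_inv[ca|[d [j dj] cd]].
  exact: olt_le_trans ca (@hsum_ge_l _ _).
apply: (@ole_lt_trans (hsum a (g j))); last first.
  by apply: olt_hsum_r; [exact: ole_refl|exact: olt_below].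
apply: ole_trans cd _; apply: ole_trans _ (IH j).
by apply: ole_oadd => //; exact: ole_refl.
Qed.

(** * Finite multiples and powers of ω *)

Lemma omulS e b : oeq (omul e (osucc b)) (omul e b + e)%ord.
Proof.
split; first by apply: osup_le => _; exact: ole_refl.
exact: (@ole_sup _ (fun=> (omul e b + e)%ord) tt).
Qed.

Lemma ole_omul e e' b b' : (e <= e' -> b <= b' -> omul e b <= omul e' b')%ord.
Proof.
move=> ee'; elim: b b' => B g IH [B' g'] bb'; apply: osup_le => j.
have [k jk] := bb' j; apply: (@ole_trans (omul e' (g' k) + e')%ord).
  by apply: ole_oadd => //; exact: IH.
exact: (@ole_sup _ (fun k => (omul e' (g' k) + e')%ord) k).
Qed.

(** Below ω^b, one is below a finite multiple of a smaller power of ω; the case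
[x <= 0] is separate because [b] may be zero. *)
Lemma olt_oexpw_inv b x : (x < ω^b)%ord -> (x <= 0)%ord \/
  exists c n, (c < b)%ord /\ (x < omul (ω^c) (onat n))%ord.
Proof.
case: b => B g /olt_osup[[j|]]; last by move/olt_osucc; left.
move/olt_osup => [n xn]; right; exists (g j), n.+1.
split; first exact: olt_below.
by apply: olt_le_trans xn _; exact: (@omulS _ _).2.
Qed.

Lemma oexpw_gt0 b : (0 < ω^b)%ord.
Proof.
case: b => B g; apply/olt_osup; exists None.
by apply/olt_osucc; exact: ole_refl.
Qed.

Lemma oexpw_ge1 b : (1 <= ω^b)%ord.
Proof. exact: (fun _ : unit => oexpw_gt0 b). Qed.

Lemma ole_oexpw a b : (a <= b -> ω^a <= ω^b)%ord.
Proof.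
elim: a b => A f IH [B g] ab; apply: osup_le => -[i|].
  have [j ij] := ab i.
  apply: ole_trans _ (@ole_sup _ (fun z : option B => match z with None => onat 1
    | Some j => omul (oexpw (g j)) omega end) (Some j)).
  by apply: ole_omul; [exact: IH|exact: ole_refl].
by move=> _; exact: oexpw_gt0.
Qed.

Lemma omul_oexpw_lt b c n : (c < b -> omul (ω^c) (onat n) < ω^b)%ord.
Proof.
case: b => B g [j cj].
apply/olt_osup; exists (Some j); apply/olt_osup; exists n => /=.
apply: (@ole_lt_trans (omul (ω^(g j)) (onat n) + 0)%ord).
  apply: ole_trans _ (@oadd_le_l _ _); apply: ole_omul; last exact: ole_refl.
  exact: ole_oexpw.
by apply: olt_oadd; exact: oexpw_gt0.
Qed.

Lemma olt_oexpw a b : (a < b -> ω^a < ω^b)%ord.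
Proof.
move=> /(@omul_oexpw_lt _ _ 1); apply: ole_lt_trans.
by apply: ole_trans _ (@omulS _ _).2; exact: oadd_le_r.
Qed.

Definition indecomposable e :=
  forall x y, (x < e)%ord -> (y < e)%ord -> (hsum x y < e)%ord.

(** Two finite multiples of an indecomposable [e], with remainders below [e], add up
naturally by adding the multiplicities and the remainders separately.  Lowering an
operand either lowers its remainder or drops one copy of [e]; the remainder that
replaces the dropped copy stays below [e] after the addition, by
indecomposability, so the bound decreases strictly in both cases. *)
Lemma hsum_omul e n m x y : indecomposable e -> (x < e)%ord -> (y < e)%ord ->
  (hsum (omul e (onat n) + x) (omul e (onat m) + y) <=
   omul e (onat (n + m)) + hsum x y)%ord.
Proof.
move=> ie; have [N nmN] := ubnP (n + m); elim: N => // N IHN in n m nmN x y *.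
elim/olt_ind: x y => x IHx; elim/olt_ind => y IHy xe ye.
(* The case of a lowered left operand; commutativity reduces the other to it. *)
have half k l u v c : (k + l < N.+1)%N -> (u < e -> v < e ->
    (forall z, z < u -> hsum (omul e (onat k) + z) (omul e (onat l) + v) <=
       omul e (onat (k + l)) + hsum z v) ->
    c < omul e (onat k) + u ->
    hsum c (omul e (onat l) + v) < omul e (onat (k + l)) + hsum u v)%ord.
  move=> klN ue ve IHu /olt_oadd_inv[|[z zu cz]]; last first.
    apply: (@ole_lt_trans (omul e (onat (k + l)) + hsum z v)%ord).
      by apply: ole_trans _ (IHu z zu); apply: ole_hsum => //; exact: ole_refl.
    by apply: olt_oadd; apply: olt_hsum_l => //; exact: ole_refl.
  case: k klN {IHu} => [|k] klN; first by move=> /olt_osup[[]].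
  move/olt_le_trans => /(_ _ (@omulS _ _).1) /olt_oadd_inv ck.
  (* [z] is the remainder left after one of the k.+1 copies of [e] is dropped. *)
  have [z ze cz] : exists2 z, (z < e)%ord & (c <= omul e (onat k) + z)%ord.
    case: ck => // /oltW ck; exists 0%ord; first exact: ole_lt_trans (@ole0 u) ue.
    exact: ole_trans ck (@oadd_le_l _ _).
  apply: (@ole_lt_trans (omul e (onat (k + l)) + hsum z v)%ord).
    apply: ole_trans _ (IHN k l _ z v ze ve) => //.
    by apply: ole_hsum => //; exact: ole_refl.
  apply: (@olt_le_trans (omul e (onat (k + l)) + e)%ord).
    by apply: olt_oadd; exact: ie.
  by apply: ole_trans _ (@oadd_le_l _ _); exact: (@omulS _ _).2.
apply/oleP => c /olt_hsum_inv[[d dx cd]|[d dy cd]]; apply: ole_lt_trans cd _.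
  apply: half dx => // z zx; apply: IHx => //.
  exact: olt_le_trans zx (oltW xe).
have mnN : (m + n < N.+1)%N by rewrite addnC.
apply: (@ole_lt_trans (hsum d (omul e (onat n) + x))%ord); first exact: hsumC.
rewrite addnC.
apply: (@olt_le_trans (omul e (onat (m + n)) + hsum y x)%ord); last first.
  by apply: ole_oadd; [exact: ole_refl|exact: hsumC].
apply: half dy => // z zy; rewrite addnC.
apply: (@ole_trans (hsum (omul e (onat n) + x) (omul e (onat m) + z))%ord).
  exact: hsumC.
apply: ole_trans (IHy z zy xe (olt_le_trans zy (oltW ye))) _.
by apply: ole_oadd; [exact: ole_refl|exact: hsumC].
Qed.

(** Two nonzero ordinals below ω^b lie below finite multiples of one smaller power
ω^e, and those multiples add up to another finite multiple of ω^e. *)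
Lemma indecomposable_oexpw b : indecomposable (ω^b).
Proof.
elim/olt_ind: b => b IH x y xb yb.
have [x0|[c [n [cb xn]]]] := olt_oexpw_inv xb.
  apply: ole_lt_trans yb; apply: ole_trans _ (@hsum0l _).
  by apply: ole_hsum => //; exact: ole_refl.
have [y0|[d [m [db ym]]]] := olt_oexpw_inv yb.
  apply: ole_lt_trans xb; apply: ole_trans _ (@hsum0 _).
  by apply: ole_hsum => //; exact: ole_refl.
have [e [eb ce de]] : exists e, [/\ (e < b)%ord, (c <= e)%ord & (d <= e)%ord].
  have [cd|/oltW dc] := ole_total c d.
    by exists d; split=> //; exact: ole_refl.
  by exists c; split=> //; exact: ole_refl.
have scale f u k : (f <= e -> u < omul (ω^f) (onat k) ->
    u <= omul (ω^e) (onat k) + 0)%ord.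
  move=> fe /oltW uk; apply: ole_trans uk (ole_trans _ (@oadd_le_l _ _)).
  by apply: ole_omul; [exact: ole_oexpw|exact: ole_refl].
have e0 := oexpw_gt0 e.
apply: ole_lt_trans (ole_hsum (scale _ _ _ ce xn) (scale _ _ _ de ym)) _.
apply: ole_lt_trans (hsum_omul _ _ (IH e eb) e0 e0) _.
apply: ole_lt_trans (omul_oexpw_lt (n + m) eb).
apply: ole_trans _ (@ole_oadd0 _).
by apply: ole_oadd; [exact: ole_refl|exact: hsum0].
Qed.

(** * Cantor normal forms and the natural product *)

Lemma cnf_valP a s : is_cnf a s -> is_cnf a (cnf a).
Proof.
move=> cs; rewrite /cnf; case: pselect => [h|[]]; last by exists s.
exact: (svalP (cid h)).
Qed.

(** If all exponents were below [a], indecomposability would keep the sum below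
ω^a.  The exponent is exhibited by a splitting of the list, as [Ord] has no
[eqType] structure to support list membership. *)
Lemma ole_oexpw_cnf_val a s : (ω^a <= cnf_val s)%ord ->
  exists s1 x s2, s = s1 ++ x :: s2 /\ (a <= x)%ord.
Proof.
elim: s => [/(olt_le_trans (oexpw_gt0 a))/olt0[]|x s IH] /= as_.
have [ax|xa] := ole_total a x; first by exists [::], x, s.
have [/IH [s1 [y [s2 [-> ay]]]]|sa] := ole_total (ω^a) (cnf_val s).
  by exists (x :: s1), y, s2.
case: (@olt_irr (ω^a)); apply: ole_lt_trans as_ _.
apply: ole_lt_trans (@oadd_le_hsum _ _) _.
by apply: indecomposable_oexpw => //; exact: olt_oexpw.
Qed.

(** The chosen normal form is only known up to [oeq], and it may list any term for
[a]; a large enough exponent is all that a lower bound on products requires. *)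
Lemma cnf_oexpw a : exists s1 x s2, cnf (ω^a) = s1 ++ x :: s2 /\ (a <= x)%ord.
Proof.
have [_ [le_cnf _]] : is_cnf (ω^a) (cnf (ω^a)).
  apply: (@cnf_valP _ [:: a]); split=> //.
  by split; [exact: oadd_le_l|exact: ole_oadd0].
exact: ole_oexpw_cnf_val le_cnf.
Qed.

Lemma oexpw0_le1 : (ω^0 <= 1)%ord.
Proof. by apply: osup_le => -[[]|]; exact: ole_refl. Qed.

(** Iterating 1 < ω^a through indecomposability of ω^a. *)
Lemma onat_lt_oexpw n a : (0 < a -> onat n < ω^a)%ord.
Proof.
move=> a0; elim: n => [|n IH]; first exact: oexpw_gt0.
apply: (@ole_lt_trans (onat n + 1)%ord).
  by move=> _; exists (inr tt); exact: (@oadd_le_l (onat n) 0%ord).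
apply: ole_lt_trans (@oadd_le_hsum _ _) _; apply: indecomposable_oexpw => //.
by apply: ole_lt_trans (olt_oexpw a0); exact: oexpw_ge1.
Qed.

Lemma oadd1_onat n : oeq (1 + onat n)%ord (onat n.+1).
Proof.
elim: n => [|n [le_n ge_n]].
  by split; [exact: ole_oadd0|exact: oadd_le_l].
split.
  by apply: ole_trans (@oadd1_osucc _).1 (ole_osucc le_n).
exact: ole_trans (ole_osucc ge_n) (@oadd1_osucc _).2.
Qed.

Lemma cnf_val_nseq0 n : oeq (cnf_val (nseq n 0%ord)) (onat n).
Proof.
elim: n => [|n [le_n ge_n]]; first by split; exact: ole_refl.
split=> /=.
  by apply: ole_trans (ole_oadd oexpw0_le1 le_n) (oadd1_onat n).1.
apply: ole_trans (oadd1_onat n).2 (ole_oadd (@oexpw_ge1 0%ord) ge_n).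
Qed.

Lemma ole_onat m n : (onat m <= onat n)%ord -> (m <= n)%N.
Proof.
by elim: m n => // m IH [|n] /(_ tt)[[]] // /IH.
Qed.

(** A positive exponent would contribute at least ω, exceeding [n], so all exponents are zero and
the sum counts its terms. *)
Lemma cnf_val_le_size s n : (cnf_val s <= onat n)%ord ->
  (cnf_val s <= onat (size s))%ord.
Proof.
elim: s => [|x s IH] sn; first exact: (@ole_refl 0%ord).
rewrite [cnf_val _]/= in sn *; rewrite [size _]/=.
have [x0|x0] := ole_total x 0%ord; last first.
  case: (@olt_irr (onat n)); apply: olt_le_trans (onat_lt_oexpw n x0) _.
  exact: ole_trans (@oadd_le_l _ _) sn.
apply: ole_trans (oadd1_onat _).1; apply: ole_oadd.
  by apply: ole_trans oexpw0_le1; exact: ole_oexpw.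
by apply: IH; exact: ole_trans (@oadd_le_r _ _) sn.
Qed.

Lemma size_cnf_onat n : (n <= size (cnf (onat n)))%N.
Proof.
have [_ [le_cnf ge_cnf]] : is_cnf (onat n) (cnf (onat n)).
  apply: (@cnf_valP _ (nseq n 0%ord)); split; last first.
    by have [] := cnf_val_nseq0 n.
  by move=> i _; rewrite !nth_nseq !if_same; exact: ole_refl.
by apply: ole_onat; apply: ole_trans le_cnf _; exact: cnf_val_le_size ge_cnf.
Qed.

Lemma hsum_nseq_le_map (T : Type) (f : T -> Ord) e n s z :
  (n <= size s)%N -> (forall x, e <= f x)%ord ->
  (foldr hsum 0 (nseq n e) <= foldr hsum z (map f s))%ord.
Proof.
move=> + ef; elim: s n => [|x s IH] [|n] //= ns; try exact: ole0.
by apply: ole_hsum => //; exact: IH.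
Qed.

Lemma foldr_hsum_ge z s : (z <= foldr hsum z s)%ord.
Proof.
elim: s => [|x s IH] /=; first exact: ole_refl.
exact: ole_trans IH (@hsum_ge_r _ _).
Qed.

(** The normal form of ω^a has an exponent [x >= a] and that of [n] has at least [n]
exponents, so the pairs with first component [x] already contribute [n] terms, each
at least ω^a. *)
Lemma hsum_nseq_le_hprod a m n : (m <= n)%N ->
  (foldr hsum 0 (nseq m (ω^a)) <= ω^a ⊗ onat n)%ord.
Proof.
move=> mn; have [s1 [x [s2 [E ax]]]] := cnf_oexpw a.
rewrite /hprod E allpairs_cat allpairs_cons !foldr_cat.
apply: ole_trans _ (@foldr_hsum_ge _ _).
apply: hsum_nseq_le_map => [|y]; first exact: leq_trans mn (size_cnf_onat n).
by apply: ole_oexpw; exact: ole_trans ax (@hsum_ge_l _ _).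
Qed.

(** * Ranks of closed sets *)

Lemma rk_lt (P : Type) (lt : P -> P -> Prop) (wf : well_founded lt) x y :
  lt y x -> (rk wf y < rk wf x)%ord.
Proof.
rewrite /rk => yx; case: (wf x) => ax /=.
by exists (exist _ y yx); exact: rk_acc_irr.
Qed.

Lemma rk_le_bound (P : Type) (lt : P -> P -> Prop) (wf : well_founded lt) x b :
  (forall y, lt y x -> (rk wf y < b)%ord) -> (rk wf x <= b)%ord.
Proof.
move=> yb; apply/oleP => c; rewrite {1}/rk; case: (wf x) => ax [[y yx] /= cy].
apply: ole_lt_trans cy (ole_lt_trans _ (yb y yx)); exact: rk_acc_irr.
Qed.

Section Noetherian.
Variables (X : topologicalType) (nX : noetherian X).

Local Notation clrk := (rk (H0_wf nX)).
Local Notation irrk := (rk (Sob_wf nX)).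

Definition closed_of (C : Sob X) : H0 X :=
  exist _ (sval C) (let: And3 cC _ _ := svalP C in cC).

Definition cap (F G : H0 X) : H0 X :=
  exist _ (sval F `&` sval G) (closedI (svalP F) (svalP G)).

Lemma clrk_mono (F G : H0 X) : sval F `<=` sval G -> (clrk F <= clrk G)%ord.
Proof.
move=> FG; apply: rk_le => D [DF nFD]; split; first exact: subset_trans FG.
by move=> GD; apply: nFD; exact: subset_trans GD.
Qed.

(** A closed set G strictly inside F is covered by its traces on F1 and F2; these
cannot be all of F1 and all of F2, since then G would contain F.  One trace thus
has smaller rank, and strict monotonicity of the natural sum concludes. *)
Lemma clrk_cover (F F1 F2 : H0 X) : sval F `<=` sval F1 `|` sval F2 ->
  (clrk F <= hsum (clrk F1) (clrk F2))%ord.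
Proof.
elim/(well_founded_ind (H0_wf nX)): F F1 F2 => F IH F1 F2 F12.
apply: rk_le_bound => G GF.
have [GF' nFG] := GF.
have GG : sval G `<=` sval (cap G F1) `|` sval (cap G F2).
  by move=> x Gx; case: (F12 x (GF' x Gx)) => ?; [left|right].
have cap_le K : (clrk (cap G K) <= clrk K)%ord by apply: clrk_mono => x [].
have cap_lt K : ~ sval K `<=` sval G -> (clrk (cap G K) < clrk K)%ord.
  by move=> nKG; apply: rk_lt; split=> [x []//|KG]; apply: nKG => x /KG[].
apply: ole_lt_trans (IH G GF _ _ GG) _.
have [F1G|/cap_lt F1G] := pselect (sval F1 `<=` sval G); last exact: olt_hsum_l.
by apply: olt_hsum_r => //; apply: cap_lt => F2G; apply: nFG => x /F12[/F1G|/F2G].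
Qed.

Lemma clrk_empty (F : H0 X) : sval F `<=` set0 -> (clrk F <= 0)%ord.
Proof.
by move=> F0; apply: rk_le_bound => G [_ nFG]; case: nFG => x /F0.
Qed.

Lemma empty_irreducible_or_union (F : H0 X) :
  [\/ sval F `<=` set0, irreducible_closed (sval F) |
   exists F1 F2 : H0 X, [/\ H0_lt F1 F, H0_lt F2 F &
      sval F `<=` sval F1 `|` sval F2]].
Proof.
have [F0|/set0P F0] := eqVneq (sval F) set0; first by constructor 1; rewrite F0.
have [irF|nirF] := pselect (irreducible_closed (sval F)).
  by constructor 2.
constructor 3; apply: contrapT => nF12; apply: nirF.
split=> //; first exact: svalP.
move=> F1 F2 cF1 cF2 F12; apply: contrapT => /not_orP[nF1 nF2]; apply: nF12.
exists (cap F (exist _ F1 cF1)), (cap F (exist _ F2 cF2)); split.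
- by split=> [x []//|FF]; apply: nF1 => x /FF[].
- by split=> [x []//|FF]; apply: nF2 => x /FF[].
- by move=> x Fx /=; case: (F12 x Fx); [left|right].
Qed.

(** Generalizing over [b] lets the irreducible case call the induction hypothesis
with the rank of F itself in place of [b]. *)
Lemma clrk_lt_oexpw (F : H0 X) b :
  (forall C : Sob X, sval C `<=` sval F -> irrk C < b)%ord ->
  (clrk F < ω^b)%ord.
Proof.
elim/(well_founded_ind (H0_wf nX)): F b => F IH b Cb.
have [F0|irF|[F1 [F2 [F1F F2F F12]]]] := empty_irreducible_or_union F.
- exact: ole_lt_trans (clrk_empty F0) (oexpw_gt0 b).
- pose C : Sob X := exist _ (sval F) irF.
  apply: (@ole_lt_trans (ω^(irrk C))); last by apply: olt_oexpw; exact: Cb.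
  apply: rk_le_bound => G GF; apply: IH => // D DG; apply: rk_lt.
  case: GF => GF nFG; split=> [|FD]; first exact: subset_trans DG GF.
  exact: nFG (subset_trans FD DG).
- apply: ole_lt_trans (clrk_cover F12) _.
  have sub G : H0_lt G F -> (clrk G < ω^b)%ord.
    move=> GF; apply: IH => // C CG; apply: Cb.
    by case: GF => GF _; exact: subset_trans CG GF.
  by apply: indecomposable_oexpw; exact: sub.
Qed.

Lemma clrk_le_oexpw (C : Sob X) : (clrk (closed_of C) <= ω^(irrk C))%ord.
Proof.
apply: rk_le_bound => F FC; apply: clrk_lt_oexpw => D DF; apply: rk_lt.
case: FC => FC nCF; split=> [|CD]; first exact: subset_trans DF FC.
exact: nCF (subset_trans CD DF).
Qed.

(** The empty closed set lies below every irreducible one and accounts for the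
leading 1. *)
Lemma irrk_le_clrk (C : Sob X) : (1 + irrk C <= clrk (closed_of C))%ord.
Proof.
elim/(well_founded_ind (Sob_wf nX)): C => C IH.
apply/oleP => c /olt_oadd_inv[/olt_osucc c0|[d dC cd]].
  have lt0C : H0_lt (exist _ set0 closed0) (closed_of C).
    by split=> // C0; case: (svalP C) => _ [x /C0].
  exact: ole_lt_trans c0 (ole_lt_trans (@ole0 _) (rk_lt _ lt0C)).
have [D DC dD] : exists2 D, Sob_lt D C & (d <= irrk D)%ord.
  move: dC; rewrite /rk; case: (Sob_wf nX C) => aC [[D DC] /= dD].
  by exists D => //; apply: ole_trans dD _; exact: rk_acc_irr.
apply: ole_lt_trans cd (ole_lt_trans (ole_oadd (@ole_refl _) dD) _).
by apply: ole_lt_trans (IH D DC) _; exact: rk_lt.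
Qed.

(** * Components *)

Lemma irreducible_decomposition (F : H0 X) : exists L : seq (set X),
  (forall C, C \in L -> irreducible_closed C) /\
  sval F `<=` \bigcup_(C in [set` L]) C.
Proof.
elim/(well_founded_ind (H0_wf nX)): F => F IH.
have [F0|irF|[F1 [F2 [/IH [L1 [ir1 FL1]] /IH [L2 [ir2 FL2]] F12]]]] :=
  empty_irreducible_or_union F.
- by exists [::]; split=> // x /F0.
- exists [:: sval F]; split=> [C|x Fx]; first by rewrite inE => /eqP ->.
  by exists (sval F) => //=; rewrite inE.
- exists (L1 ++ L2); split=> [C|x /F12[/FL1|/FL2] [C CL Cx]].
  + by rewrite mem_cat => /orP[/ir1|/ir2].
  + by exists C => //=; rewrite mem_cat [_ \in _]CL.
  + by exists C => //=; rewrite mem_cat [_ \in L2]CL orbT.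
Qed.

(** Irreducibility, extended from two to finitely many closed sets. *)
Lemma irreducible_sub_bigcup (L : seq (set X)) (C : set X) :
  (forall D, D \in L -> closed D) -> irreducible_closed C ->
  C `<=` \bigcup_(D in [set` L]) D -> exists2 D, D \in L & C `<=` D.
Proof.
move=> + irC; elim: L => [_|D L IH cL].
  by rewrite bigcup_seq big_nil; case: irC => _ [x Cx] _ /(_ x Cx).
rewrite bigcup_seq big_cons -bigcup_seq => CDL.
case: (irC) => _ _ /(_ D (\bigcup_(D in [set` L]) D)).
have cL' E : E \in L -> closed E by move=> EL; apply: cL; rewrite inE EL orbT.
case=> //; first by apply: cL; rewrite inE eqxx.
- by rewrite bigcup_seq; exact: closed_bigsetU.
- by exists D => //; rewrite inE eqxx.
- by move=> /(IH cL')[E EL CE]; exists E => //; rewrite inE EL orbT.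
Qed.

(** A finite irreducible cover contains every component, by maximality.  Conversely,
a member that is not a component lies in a larger irreducible set, hence in another
member, so it can be discarded; this stops at a cover by components. *)
Lemma components_cover : exists L : seq (set X),
  [/\ uniq L, (forall C, C \in L -> components C),
      finite_set (@components X) &
      [set: X] `<=` \bigcup_(C in [set` L]) C].
Proof.
have [L0 [irL0 cover0]] := irreducible_decomposition (exist _ [set: X] closedT).
have closed_irr (L : seq (set X)) :
    (forall C, C \in L -> irreducible_closed C) ->
    forall C, C \in L -> closed C.
  by move=> irL C /irL[].
have fin : finite_set (@components X).
  apply: (@sub_finite_set _ _ [set` L0]); last exact: finite_seq.
  move=> C [irC maxC] /=.
  have [D DL CD] := irreducible_sub_bigcup (closed_irr _ irL0) irC
    (subset_trans (@subsetT _ C) cover0).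
  by rewrite -(maxC D (irL0 D DL) CD).
have [n] := ubnP (size L0).
elim: n => // n IH in L0 irL0 cover0 *; rewrite ltnS => Ln.
have [all_comp|] := pselect (forall C, C \in L0 -> components C).
  exists (undup L0); split=> //; first exact: undup_uniq.
    by move=> C; rewrite mem_undup => /all_comp.
  by move=> x /cover0[C CL Cx]; exists C => //=; rewrite mem_undup.
move=> /existsNP[C /not_implyP[CL nC]].
have [D [irD CD DC]] : exists D, [/\ irreducible_closed D, C `<=` D & D <> C].
  apply: contrapT => noD; apply: nC; split; first exact: irL0.
  by move=> D irD CD; apply: contrapT => DC; apply: noD; exists D.
have [E EL DE] := irreducible_sub_bigcup (closed_irr _ irL0) irD
  (subset_trans (@subsetT _ D) cover0).
have EC : E != C.
  by apply/eqP => EC; apply: DC; apply/seteqP; split=> //; rewrite -EC.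
apply: (IH [seq E <- L0 | predC1 C E]).
- by move=> G; rewrite mem_filter => /andP[_ /irL0].
- move=> x /cover0[G GL Gx]; have [GC|GC] := eqVneq G C; last first.
    by exists G => //=; rewrite mem_filter /= GC.
  (* Points of the discarded set [C] lie in [E], since C `<=` D `<=` E. *)
  exists E; first by rewrite /= mem_filter /= EC.
  by apply: DE; apply: CD; rewrite -GC.
- apply: leq_trans Ln; rewrite size_filter -(count_predC (predC1 C) L0).
  rewrite -addn1 leq_add2l.
  by rewrite -has_count; apply/hasP; exists C => //=; rewrite negbK.
Qed.

Lemma clrk_le_hsum_nseq (L : seq (set X)) e (F : H0 X) :
  (forall C, C \in L -> exists2 H : H0 X, sval H = C & (clrk H <= e)%ord) ->
  sval F `<=` \bigcup_(C in [set` L]) C ->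
  (clrk F <= foldr hsum 0 (nseq (size L) e))%ord.
Proof.
elim: L F => [|C L IH] F le_e.
  by rewrite bigcup_seq big_nil => /clrk_empty.
rewrite bigcup_seq big_cons -bigcup_seq => FCL.
have [H HC He] := le_e C (mem_head _ _).
have le_eL D : D \in L -> exists2 H : H0 X, sval H = D & (clrk H <= e)%ord.
  by move=> DL; apply: le_e; rewrite inE DL orbT.
have cL : closed (\bigcup_(D in [set` L]) D).
  rewrite bigcup_seq; apply: closed_bigsetU => D /le_eL[K <- _]; exact: svalP.
apply: ole_trans (@clrk_cover F H (exist _ _ cL) _) _; first by rewrite HC.
by apply: ole_hsum => //; exact: IH.
Qed.

End Noetherian.

(** * The bounds on the stature *)

Theorem proposition4p5 (X : topologicalType) (nX : noetherian X) :
  [/\ (1 + sob nX <= stature nX + 1)%ord /\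
      ([set: X] !=set0 -> (1 + rsob nX <= stature nX)%ord),
      (stature nX + 1 <= ω^(sob nX))%ord &
      ([set: X] !=set0 ->
       (stature nX <= ω^(rsob nX) ⊗ onat (ncomponents X))%ord)].
Proof.
have [st_le st_ge] := stature_rk nX.
have clrk_le_st (F : H0 X) : (rk (H0_wf nX) F <= stature nX)%ord.
  by apply: ole_trans st_ge; exact: clrk_mono.
have irrk_le_st (C : Sob X) : (1 + rk (Sob_wf nX) C <= stature nX)%ord.
  exact: ole_trans (irrk_le_clrk nX C) (clrk_le_st _).
split; first split.
- apply/oleP => c /olt_oadd_inv[/olt_osucc c0|[d [C dC] cd]].
    apply: ole_lt_trans c0 _; apply: ole_lt_trans (ole0 (stature nX + 0)%ord) _.
    by apply: olt_oadd; apply/olt_osucc; exact: ole_refl.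
  apply: ole_lt_trans (ole_trans cd (ole_oadd (@ole_refl _) dC)) _.
  apply: ole_lt_trans (irrk_le_st C) _.
  apply: ole_lt_trans (@oadd_le_l _ 0%ord) _.
  by apply: olt_oadd; apply/olt_osucc; exact: ole_refl.
- move=> [x _]; apply/oleP => c /olt_oadd_inv[/olt_osucc c0|[d]].
    have lt0X : H0_lt (exist _ set0 closed0) (exist _ [set: X] closedT).
      by split=> // /(_ x I).
    apply: ole_lt_trans c0 _; apply: olt_le_trans st_ge.
    exact: ole_lt_trans (@ole0 _) (rk_lt _ lt0X).
  move=> /olt_osup[C dC] cd; apply: olt_le_trans (irrk_le_st C).
  by apply: ole_lt_trans cd _; exact: olt_oadd.
- apply: ole_oadd1; apply: ole_lt_trans st_le _; apply: clrk_lt_oexpw => C _.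
  exact: olt_below.
- move=> _; have [L [uL compL finC cover]] := components_cover nX.
  have Ln : (size L <= ncomponents X)%N.
    apply: uniq_leq_size uL _ => C /compL CX.
    by have := in_fset_set finC C; rewrite (mem_set CX).
  apply: ole_trans st_le _; apply: ole_trans _ (hsum_nseq_le_hprod _ Ln).
  apply: clrk_le_hsum_nseq => // C /compL[irC _].
  exists (closed_of (exist _ C irC)) => //.
  apply: ole_trans (clrk_le_oexpw nX _) _; apply: ole_oexpw.
  exact: (@ole_sup _ (rk (Sob_wf nX))).
Qed.
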